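(* Let $f\colon[0,1]\to[0,1]$ be continuous and topologically mixing. Then there are $n\in\mathbb N$, $\varepsilon>0$ and a dense Mycielski set $T\subset[0,1]$ with $f^{2^n}(T)\subset T$ such that $T$ is syndetically $\varepsilon$-scrambled for $f$.
   Context: Mixing: for all nonempty open $U,V$, $\{m: f^m(U)\cap V\ne\emptyset\}$ is cofinite. Syndetic: subset of $\mathbb N$ meeting every set with arbitrarily long runs of consecutive integers. A set $S$ with at least two points is syndetically $\varepsilon$-scrambled for $f$ if for every distinct $x,y\in S$: $\{m:|f^mx-f^my|<\eta\}$ is syndetic for every $\eta>0$, $|f^mx-f^my|\not\to0$, and $\limsup_m|f^mx-f^my|\ge\varepsilon$. Mycielski set: countable union of Cantor sets (nonempty compact perfect totally disconnected sets). *)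

(* Defs.v *)
From Stdlib Require Import Reals Rtopology.
Open Scope R_scope.

Definition I01 (x : R) : Prop := 0 <= x <= 1.

Definition maps_I01 (f : R -> R) : Prop := forall x, I01 x -> I01 (f x).

Definition continuous_on_I01 (f : R -> R) : Prop :=
  forall x, I01 x -> forall eps, 0 < eps ->
    exists delta, 0 < delta /\
      forall y, I01 y -> Rabs (y - x) < delta -> Rabs (f y - f x) < eps.

Definition open_in_I01 (U : R -> Prop) : Prop :=
  (forall x, U x -> I01 x) /\
  (forall x, U x -> exists r, 0 < r /\ forall y, I01 y -> Rabs (y - x) < r -> U y).

Fixpoint iter (m : nat) (f : R -> R) (x : R) : R :=
  match m with O => x | S k => f (iter k f x) end.

Definition mixing_I01 (f : R -> R) : Prop :=
  forall U V, open_in_I01 U -> open_in_I01 V ->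
    (exists u, U u) -> (exists v, V v) ->
    exists N : nat, forall m : nat, (N <= m)%nat -> exists x, U x /\ V (iter m f x).

Definition thick (A : nat -> Prop) : Prop :=
  forall L : nat, exists k : nat, forall i : nat, (i < L)%nat -> A (k + i)%nat.

Definition syndetic (S : nat -> Prop) : Prop :=
  forall A, thick A -> exists m, S m /\ A m.

Definition limsup_ge (a : nat -> R) (eps : R) : Prop :=
  forall c, c < eps -> forall N : nat, exists m : nat, (N <= m)%nat /\ c < a m.

Definition syndetically_scrambled (f : R -> R) (eps : R) (S : R -> Prop) : Prop :=
  (exists x y, S x /\ S y /\ x <> y) /\
  forall x y, S x -> S y -> x <> y ->
    (forall eta, 0 < eta -> syndetic (fun m => Rabs (iter m f x - iter m f y) < eta)) /\
    ~ Un_cv (fun m => Rabs (iter m f x - iter m f y)) 0 /\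
    limsup_ge (fun m => Rabs (iter m f x - iter m f y)) eps.

Definition perfect (K : R -> Prop) : Prop :=
  closed_set K /\
  forall x, K x -> forall r, 0 < r -> exists y, K y /\ y <> x /\ Rabs (y - x) < r.

Definition connected_set (C : R -> Prop) : Prop :=
  ~ exists U V : R -> Prop, open_set U /\ open_set V /\
      (forall x, C x -> U x \/ V x) /\
      (exists x, C x /\ U x) /\ (exists x, C x /\ V x) /\
      (forall x, C x -> U x -> V x -> False).

Definition totally_disconnected (K : R -> Prop) : Prop :=
  forall C : R -> Prop, (forall x, C x -> K x) -> connected_set C ->
    forall x y, C x -> C y -> x = y.

Definition cantor_set (K : R -> Prop) : Prop :=
  (exists x, K x) /\ compact K /\ perfect K /\ totally_disconnected K.

Definition mycielski (T : R -> Prop) : Prop :=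
  exists K : nat -> (R -> Prop), (forall i, cantor_set (K i)) /\
    forall x, T x <-> exists i, K i x.

Definition dense_in_I01 (T : R -> Prop) : Prop :=
  (forall x, T x -> I01 x) /\
  forall x, I01 x -> forall r, 0 < r -> exists t, T t /\ Rabs (t - x) < r.

(* Main.v *)
(** Since [f] is mixing, a large iterate of any interval contains [[1/5, 4/5]], so
for large [n] the map [g = f^(2^n)] has a horseshoe on [A = [1/5, 2/5]] and
[B = [3/5, 4/5]].  Nested intervals [A = A_0 ⊃ A_1 ⊃ …] with [g(A_{l+1}) = A_l]
shrink to a point [p], because a mixing map traps no nondegenerate interval.
A point of [T] chooses between [A] and [B], as dictated by a code, at the sparse times
[2^j], and in between runs down the [A_l]; hence it is close to [p] except at boundedly
many steps around the powers of 2, and this is stable under time shifts.  So two points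
of [T], even on the same orbit, are close along a syndetic set.  Distinct codes differ
infinitely often, and for different shifts a visit of one point to [B] is matched
infinitely often by a visit of the other one to [A]; this gives the separation.
Taking a Cantor set of codes inside each interval of a countable grid, together with all
its images under [g], makes [T] dense and invariant. *)

Require Import Defs.
From Stdlib Require Import Reals Rtopology Lra Lia Arith Cantor ClassicalEpsilon Classical
  FunctionalExtensionality.
Open Scope R_scope.

(** * Intermediate values, interval coverings and nested intervals *)

Definition inI (J : R * R) (x : R) : Prop := fst J <= x <= snd J.

Definition covers (h : R -> R) (J K : R * R) : Prop :=
  forall y, inI K y -> exists x, inI J x /\ h x = y.

(** The library limit runs over a punctured neighbourhood; the point [y = x] satisfies the estimate
    trivially. *)
Lemma continuity_eps (h : R -> R) :
  continuity h <->
  forall x eps, 0 < eps -> exists delta, 0 < delta /\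
    forall y, Rabs (y - x) < delta -> Rabs (h y - h x) < eps.
Proof.
  split.
  - intros H x eps He. destruct (H x eps He) as [dl [Hd H1]].
    exists dl; split; [exact Hd|]. intros y Hy.
    destruct (Req_dec x y) as [<-|Hne].
    + rewrite Rminus_diag, Rabs_R0; exact He.
    + apply H1. split; [split; [exact I|exact Hne]|exact Hy].
  - intros H x eps He. destruct (H x eps He) as [dl [Hd H1]].
    exists dl; split; [exact Hd|]. intros y [_ Hy]. apply H1, Hy.
Qed.

Lemma ivt (h : R -> R) (u v y : R) :
  continuity h -> u <= v -> h u <= y <= h v \/ h v <= y <= h u ->
  exists z, u <= z <= v /\ h z = y.
Proof.
  intros Hh Huv Hy.
  destruct (IVT_cor (fun x => h x - y) u v) as [z [Hz1 Hz2]].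
  - apply continuity_minus; [exact Hh|]. apply continuity_const. intros ? ?; reflexivity.
  - exact Huv.
  - destruct Hy; nra.
  - exists z; split; [exact Hz1|lra].
Qed.

(** [w] is the supremum of the points before which [y] is not taken. Were [h w <> y], continuity
    would keep [h] away from [y] a little beyond [w]. *)
Lemma first_hit (h : R -> R) (u v y : R) :
  continuity h -> u <= v -> h v = y ->
  exists w, u <= w <= v /\ h w = y /\ forall x, u <= x < w -> h x <> y.
Proof.
  intros Hh Huv Hv.
  pose (E := fun t => t <= v /\ forall x, u <= x < t -> h x <> y).
  assert (HuE : E u) by (split; [exact Huv|intros x Hx; lra]).
  destruct (completeness E) as [w [Hub Hlub]].
  - exists v; intros t [Ht _]; exact Ht.
  - exists u; exact HuE.
  - assert (Hwv : w <= v) by (apply Hlub; intros t [Ht _]; exact Ht).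
    assert (Huw : u <= w) by (apply Hub, HuE).
    assert (Hbefore : forall x, u <= x < w -> h x <> y).
    { intros x Hx Hxy.
      assert (w <= x); [|lra].
      apply Hlub. intros t [_ Ht]. apply Rnot_lt_le. intros Hlt.
      apply (Ht x); [lra|exact Hxy]. }
    exists w; split; [lra|split; [|exact Hbefore]].
    apply NNPP; intros Hne.
    destruct (proj1 (continuity_eps h) Hh w (Rabs (h w - y))) as [dl [Hd Hnear]].
    { apply Rabs_pos_lt; lra. }
    assert (Hlt : w < v) by (destruct Hwv as [|Heq]; [assumption|rewrite Heq in Hne; contradiction]).
    set (t := Rmin v (w + dl / 2)).
    assert (Ht : w < t) by (apply Rmin_glb_lt; lra).
    assert (HE : E t).
    { split; [apply Rmin_l|]. intros x Hx Hxy.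
      destruct (Rlt_le_dec x w) as [Hxw|Hxw]; [apply (Hbefore x); [lra|exact Hxy]|].
      assert (Hx2 : x <= w + dl / 2) by (pose proof (Rmin_r v (w + dl / 2)); fold t in H; lra).
      assert (Hx3 : Rabs (x - w) < dl) by (apply Rabs_def1; lra).
      specialize (Hnear x Hx3). rewrite Hxy in Hnear.
      rewrite Rabs_minus_sym in Hnear. lra. }
    apply Hub in HE. lra.
Qed.

Lemma last_hit (h : R -> R) (u v y : R) :
  continuity h -> u <= v -> h u = y ->
  exists w, u <= w <= v /\ h w = y /\ forall x, w < x <= v -> h x <> y.
Proof.
  intros Hh Huv Hu.
  destruct (first_hit (fun x => h (- x)) (- v) (- u) y) as [w [Hw1 [Hw2 Hw3]]].
  - apply (continuity_comp Ropp h); [|exact Hh].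
    apply (continuity_opp id). apply derivable_continuous, derivable_id.
  - lra.
  - rewrite Ropp_involutive; exact Hu.
  - exists (- w); split; [lra|split; [exact Hw2|]].
    intros x Hx Hxy. apply (Hw3 (- x)); [lra|rewrite Ropp_involutive; exact Hxy].
Qed.

(** Take the first hit [w] of [h v], then the last hit [w'] of [h u] before [w]. A value outside the
    range between them would, by intermediate values, force an earlier hit of [h v] or a later hit
    of [h u]. *)
Lemma subinterval_ordered (h : R -> R) (u v : R) :
  continuity h -> u <= v -> h u <= h v ->
  exists J, fst J <= snd J /\ (forall x, inI J x -> u <= x <= v) /\
    (forall x, inI J x -> h u <= h x <= h v) /\ covers h J (h u, h v).
Proof.
  intros Hh Huv Hle.
  destruct (first_hit h u v (h v) Hh Huv eq_refl) as [w [Hw1 [Hw2 Hw3]]].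
  destruct (last_hit h u w (h u) Hh (proj1 Hw1) eq_refl) as [w' [Hw1' [Hw2' Hw3']]].
  exists (w', w). unfold inI; simpl. split; [lra|split; [intros; lra|split]].
  - intros x Hx. split; apply Rnot_lt_le; intros Hlt.
    + destruct (ivt h x w (h u) Hh) as [z [Hz1 Hz2]]; [lra|left; lra|].
      destruct (Rle_lt_dec z w') as [Hz|Hz].
      * assert (x = w') by lra. subst x. lra.
      * apply (Hw3' z); [lra|exact Hz2].
    + destruct (ivt h u x (h v) Hh) as [z [Hz1 Hz2]]; [lra|left; lra|].
      destruct (Rle_lt_dec w z) as [Hz|Hz].
      * assert (x = w) by lra. subst x. lra.
      * apply (Hw3 z); [lra|exact Hz2].
  - intros y Hy. unfold inI in *; simpl in *. apply ivt; [exact Hh|lra|left; lra].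
Qed.

(** Apply the ordered case to preimages of the two ends of [K]; if they come in the wrong order,
    reflect the line. *)
Lemma subinterval (h : R -> R) (J K : R * R) :
  continuity h -> fst K <= snd K -> covers h J K ->
  exists J', fst J' <= snd J' /\ (forall x, inI J' x -> inI J x) /\
    (forall x, inI J' x -> inI K (h x)) /\ covers h J' K.
Proof.
  destruct J as [j1 j2], K as [k1 k2]; unfold inI; simpl. intros Hh HK Hcov.
  destruct (Hcov k1) as [u [Hu1 Hu2]]; [unfold inI; simpl; lra|].
  destruct (Hcov k2) as [v [Hv1 Hv2]]; [unfold inI; simpl; lra|].
  unfold inI in Hu1, Hv1; simpl in Hu1, Hv1.
  destruct (Rle_lt_dec u v) as [Huv|Huv].
  - destruct (subinterval_ordered h u v Hh Huv) as [J [H1 [H2 [H3 H4]]]]; [lra|].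
    rewrite Hu2, Hv2 in H3, H4.
    exists J; split; [exact H1|split; [|split; [exact H3|exact H4]]].
    intros x Hx. specialize (H2 x Hx). lra.
  - destruct (subinterval_ordered (fun x => h (- x)) (- u) (- v)) as [J [H1 [H2 [H3 H4]]]].
    + apply (continuity_comp Ropp h); [|exact Hh].
      apply (continuity_opp id). apply derivable_continuous, derivable_id.
    + lra.
    + rewrite !Ropp_involutive. lra.
    + rewrite !Ropp_involutive in H3, H4. rewrite Hu2, Hv2 in H3, H4.
      unfold inI in H2, H3.
      exists (- snd J, - fst J); simpl. split; [lra|split; [|split]].
      * intros x Hx. specialize (H2 (- x)). lra.
      * intros x Hx. specialize (H3 (- x)). rewrite Ropp_involutive in H3. apply H3; lra.
      * intros y Hy. destruct (H4 y Hy) as [x [Hx1 Hx2]].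
        exists (- x); split; [unfold inI in *; simpl; lra|exact Hx2].
Qed.

(** The supremum of the left ends and the infimum of the right ends lie in all the intervals, so
    uniqueness makes them equal, and the ends converge to this point. *)
Lemma nested_intervals (J : nat -> R * R) :
  (forall m, fst (J m) <= snd (J m)) ->
  (forall m x, inI (J (S m)) x -> inI (J m) x) ->
  (forall x y, (forall m, inI (J m) x) -> (forall m, inI (J m) y) -> x = y) ->
  exists x, (forall m, inI (J m) x) /\
    forall r, 0 < r -> exists M, forall y, inI (J M) y -> Rabs (y - x) < r.
Proof.
  intros Hne Hdec Huniq.
  assert (Hmono : forall k m x, (k <= m)%nat -> inI (J m) x -> inI (J k) x).
  { intros k m x Hkm. induction Hkm as [|m Hkm IH]; [auto|]. intros Hx. apply IH, Hdec, Hx. }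
  assert (Hends : forall k m, (k <= m)%nat ->
      inI (J k) (fst (J m)) /\ inI (J k) (snd (J m))).
  { intros k m Hkm. specialize (Hne m).
    split; apply (Hmono k m _ Hkm); unfold inI; lra. }
  assert (Hcross : forall k m, fst (J k) <= snd (J m)).
  { intros k m. destruct (Nat.le_ge_cases k m) as [H|H];
      destruct (Hends _ _ H) as [[? ?] [? ?]]; specialize (Hne m); lra. }
  destruct (completeness (fun t => exists m, t = fst (J m))) as [l [Hl1 Hl2]].
  { exists (snd (J 0%nat)). intros t [m ->]. apply Hcross. }
  { exists (fst (J 0%nat)), 0%nat; reflexivity. }
  (* The infimum of the right ends is [- u], obtained as a supremum of negatives. *)
  destruct (completeness (fun t => exists m, t = - snd (J m))) as [u [Hu1 Hu2]].
  { exists (- fst (J 0%nat)). intros t [m ->]. apply Ropp_le_contravar, Hcross. }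
  { exists (- snd (J 0%nat)), 0%nat; reflexivity. }
  assert (Hl : forall m, inI (J m) l).
  { intros m; split; [apply Hl1; exists m; reflexivity|].
    apply Hl2. intros t [k ->]. apply Hcross. }
  assert (Hu : forall m, inI (J m) (- u)).
  { intros m; split.
    - apply Ropp_le_cancel. rewrite Ropp_involutive. apply Hu2.
      intros t [k ->]. apply Ropp_le_contravar, Hcross.
    - assert (- snd (J m) <= u) by (apply Hu1; exists m; reflexivity). lra. }
  pose proof (Huniq _ _ Hl Hu) as Hlu.
  exists l; split; [exact Hl|]. intros r Hr.
  destruct (classic (exists m, l - r < fst (J m))) as [[m1 Hm1]|Hno].
  2:{ exfalso. assert (l <= l - r); [|lra]. apply Hl2. intros t [m ->].
      apply Rnot_lt_le. intros H; apply Hno; exists m; exact H. }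
  destruct (classic (exists m, snd (J m) < l + r)) as [[m2 Hm2]|Hno].
  2:{ exfalso. assert (u <= u - r); [|lra]. apply Hu2. intros t [m ->].
      apply Rnot_lt_le. intros H; apply Hno; exists m; lra. }
  exists (max m1 m2). intros y Hy.
  destruct (Hmono m1 (max m1 m2) y) as [H1 _]; [lia|exact Hy|].
  destruct (Hmono m2 (max m1 m2) y) as [_ H2]; [lia|exact Hy|].
  apply Rabs_def1; lra.
Qed.

(** * Cantor sets as injective continuous images of the Cantor space *)

Definition agree (n : nat) (al be : nat -> bool) : Prop :=
  forall k, (k < n)%nat -> al k = be k.

Definition flip_at (n : nat) (al : nat -> bool) (v : bool) : nat -> bool :=
  fun k => if Nat.eqb k n then v else al k.

(** Continuity for the product topology on codes, whose basic neighbourhoods fix a finite prefix. It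
    also forces equal values at pointwise equal codes. *)
Definition cantor_continuous (y : (nat -> bool) -> R) : Prop :=
  forall al r, 0 < r -> exists M, forall be, agree M al be -> Rabs (y be - y al) < r.

Lemma closed_set_intro (D : R -> Prop) :
  (forall x, (forall r, 0 < r -> exists y, D y /\ Rabs (y - x) < r) -> D x) ->
  closed_set D.
Proof.
  intros H x Hx. apply NNPP; intros Hno. apply Hx, H. intros r Hr.
  apply NNPP; intros Hno2. apply Hno. exists (mkposreal r Hr).
  intros y Hy Dy. apply Hno2. exists y; split; [exact Dy|exact Hy].
Qed.

(* Koenig's lemma: at a point adherent to the image, one digit of the code is fixed at a time. *)
Lemma closed_image (y : (nat -> bool) -> R) (P : (nat -> bool) -> Prop) :
  cantor_continuous y ->
  (forall al, (forall n, exists be, agree n al be /\ P be) -> P al) ->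
  closed_set (fun x => exists al, P al /\ x = y al).
Proof.
  intros Hy HP. apply closed_set_intro. intros x Hx.
  pose (Q := fun n sg => forall r, 0 < r -> exists al,
    agree n sg al /\ P al /\ Rabs (y al - x) < r).
  pose (step := fun n sg =>
    if excluded_middle_informative (Q (S n) (flip_at n sg true))
    then flip_at n sg true else flip_at n sg false).
  assert (Hstep : forall n sg, Q n sg -> Q (S n) (step n sg)).
  { intros n sg Hq. unfold step.
    destruct (excluded_middle_informative _) as [H|H]; [exact H|].
    apply not_all_ex_not in H. destruct H as [r0 H].
    apply imply_to_and in H. destruct H as [Hr0 H].
    (* Below the radius [r0], at which the digit [true] fails, only the digit [false] is left. *)
    intros r Hr. destruct (Hq (Rmin r r0)) as [al [H1 [H2 H3]]]; [apply Rmin_pos; lra|].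
    pose proof (Rmin_l r r0). pose proof (Rmin_r r r0).
    destruct (al n) eqn:Hal.
    - exfalso. apply H. exists al; split; [|split; [exact H2|lra]].
      intros k Hk. unfold flip_at. destruct (Nat.eqb_spec k n) as [->|Hne]; [auto|apply H1; lia].
    - exists al; split; [|split; [exact H2|lra]].
      intros k Hk. unfold flip_at. destruct (Nat.eqb_spec k n) as [->|Hne]; [auto|apply H1; lia]. }
  pose (sg := fix sg n := match n with O => fun _ => true | S k => step k (sg k) end).
  assert (HQ : forall n, Q n (sg n)).
  { induction n as [|n IH]; [|apply Hstep, IH].
    intros r Hr. destruct (Hx r Hr) as [z [[al [H1 ->]] H2]].
    exists al; split; [intros k Hk; lia|split; assumption]. }
  (* Digit [k] is settled at stage [S k] and never changed, so the diagonal code [al] below extends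
     every finite stage. *)
  assert (Hsg : forall k i, sg (S k + i)%nat k = sg (S k) k).
  { intros k i. induction i as [|i IH]; [rewrite Nat.add_0_r; reflexivity|].
    rewrite <- IH, Nat.add_succ_r. simpl sg at 1. unfold step at 1.
    destruct (excluded_middle_informative _); unfold flip_at;
      destruct (Nat.eqb_spec k (S (k + i))); try lia; reflexivity. }
  pose (al := fun k => sg (S k) k).
  assert (Hal : forall n, agree n al (sg n)).
  { intros n k Hk. unfold al. rewrite <- (Hsg k (n - S k)%nat). f_equal; lia. }
  assert (Hlim : forall n r, 0 < r -> exists be, agree n al be /\ P be /\ Rabs (y be - x) < r).
  { intros n r Hr. destruct (HQ n r Hr) as [be [H1 H2]].
    exists be; split; [|exact H2]. intros k Hk. rewrite (Hal n k Hk). apply H1, Hk. }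
  exists al; split.
  - apply HP. intros n. destruct (Hlim n 1 Rlt_0_1) as [be [H1 [H2 _]]]. exists be; auto.
  - apply cond_eq. intros eps He.
    destruct (Hy al (eps / 2)) as [M HM]; [lra|].
    destruct (Hlim M (eps / 2)) as [be [H1 [_ H2]]]; [lra|].
    specialize (HM be H1).
    apply Rabs_def2 in HM. apply Rabs_def2 in H2. apply Rabs_def1; lra.
Qed.


Lemma closed_set_ext (D E : R -> Prop) :
  (forall x, D x <-> E x) -> closed_set D -> closed_set E.
Proof.
  intros H HD x Hx. destruct (HD x) as [dl Hdl].
  - intros Dx. apply Hx, H, Dx.
  - exists dl. intros t Ht Et. apply (Hdl t Ht), H, Et.
Qed.

(** Compactness is Heine-Borel, changing a late digit gives nearby points, and fixing one digit
    splits the image into two disjoint closed pieces, which disconnects any two distinct points. *)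
Lemma cantor_set_image (y : (nat -> bool) -> R) :
  cantor_continuous y ->
  (forall al be k, y al = y be -> al k = be k) ->
  (forall al, I01 (y al)) ->
  cantor_set (fun x => exists al, x = y al).
Proof.
  intros Hy Hinj HI.
  assert (Hclosed : closed_set (fun x => exists al, x = y al)).
  { apply (closed_set_ext (fun x => exists al, True /\ x = y al)).
    - intros x; split; intros [al H]; exists al; tauto.
    - apply closed_image; [exact Hy|auto]. }
  assert (Hdigit : forall k v, closed_set (fun x => exists al, al k = v /\ x = y al)).
  { intros k v. apply closed_image; [exact Hy|]. intros al H.
    destruct (H (S k)) as [be [H1 <-]]. apply H1; lia. }
  split; [exists (y (fun _ => true)), (fun _ => true); reflexivity|].
  split; [|split; [split; [exact Hclosed|]|]].
  - apply compact_P5; [exact Hclosed|]. exists 0, 1. intros x [al ->]. apply HI.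
  - intros x [al ->] r Hr. destruct (Hy al r Hr) as [M HM].
    exists (y (flip_at M al (negb (al M)))).
    split; [eexists; reflexivity|split].
    + intros Heq. apply (fun H => Hinj _ _ M H) in Heq. unfold flip_at in Heq.
      rewrite Nat.eqb_refl in Heq. destruct (al M); discriminate.
    + apply HM. intros k Hk. unfold flip_at. destruct (Nat.eqb_spec k M); [lia|reflexivity].
  - intros C HCK HC u v Hu Hv. apply NNPP; intros Huv.
    destruct (HCK u Hu) as [al Hal], (HCK v Hv) as [be Hbe].
    destruct (classic (forall k, al k = be k)) as [Heq|Hne].
    + apply Huv. rewrite Hal, Hbe. apply cond_eq. intros eps He.
      destruct (Hy be eps He) as [M HM]. apply HM. intros k _. symmetry; apply Heq.
    + apply not_all_ex_not in Hne. destruct Hne as [k Hk]. apply HC.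
      (* Each open set is the complement of the closed piece carrying the digit of the other
         point. *)
      exists (complementary (fun x => exists al', al' k = be k /\ x = y al')),
             (complementary (fun x => exists al', al' k = al k /\ x = y al')).
      split; [apply Hdigit|split; [apply Hdigit|split; [|split; [|split]]]].
      * intros x Hx. destruct (HCK x Hx) as [ga ->].
        destruct (Bool.bool_dec (ga k) (be k)) as [E|E].
        -- right. intros [ga' [H1 H2]]. apply (fun H => Hinj _ _ k H) in H2. congruence.
        -- left. intros [ga' [H1 H2]]. apply (fun H => Hinj _ _ k H) in H2. congruence.
      * exists u; split; [exact Hu|]. intros [ga' [H1 H2]].
        rewrite Hal in H2. apply (fun H => Hinj _ _ k H) in H2. congruence.
      * exists v; split; [exact Hv|]. intros [ga' [H1 H2]].
        rewrite Hbe in H2. apply (fun H => Hinj _ _ k H) in H2. congruence.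
      * intros x Hx H1 H2. destruct (HCK x Hx) as [ga ->].
        assert (ga k <> be k) by (intros E; apply H1; exists ga; auto).
        assert (ga k <> al k) by (intros E; apply H2; exists ga; auto).
        destruct (ga k), (al k), (be k); congruence.
Qed.

(** * Iterates and composition of coverings *)

Lemma iter_add (h : R -> R) (m n : nat) (x : R) : iter (m + n) h x = iter m h (iter n h x).
Proof. induction m as [|m IH]; [reflexivity|simpl; rewrite IH; reflexivity]. Qed.

Lemma iter_mul (h : R -> R) (m n : nat) (x : R) : iter (m * n) h x = iter m (iter n h) x.
Proof. induction m as [|m IH]; [reflexivity|]. simpl. rewrite iter_add, IH. reflexivity. Qed.

Lemma continuity_iter (h : R -> R) (m : nat) : continuity h -> continuity (iter m h).
Proof.
  intros Hh. induction m as [|m IH].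
  - apply derivable_continuous, derivable_id.
  - exact (continuity_comp (iter m h) h IH Hh).
Qed.

Lemma iter_I01 (h : R -> R) (m : nat) (x : R) : maps_I01 h -> I01 x -> I01 (iter m h x).
Proof. intros Hh Hx. induction m as [|m IH]; [exact Hx|apply Hh, IH]. Qed.

Lemma covers_comp (h k : R -> R) (J K L : R * R) :
  covers h J K -> covers k K L -> covers (fun x => k (h x)) J L.
Proof.
  intros H1 H2 y Hy. destruct (H2 y Hy) as [z [Hz <-]].
  destruct (H1 z Hz) as [x [Hx <-]]. exists x; auto.
Qed.

Lemma covers_sub (h : R -> R) (J K L : R * R) :
  (forall x, inI L x -> inI K x) -> covers h J K -> covers h J L.
Proof. intros H1 H2 y Hy. apply H2, H1, Hy. Qed.

(** * Points following a prescribed itinerary of a horseshoe *)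

(** A fixed choice of the trimmed interval, so that nested sequences can be defined by recursion and
    equal data give the same interval. Without a covering the value is arbitrary. *)
Definition sub (h : R -> R) (J K : R * R) : R * R :=
  epsilon (inhabits (0, 0)) (fun J' => fst J' <= snd J' /\ (forall x, inI J' x -> inI J x) /\
    (forall x, inI J' x -> inI K (h x)) /\ covers h J' K).

Lemma sub_spec (h : R -> R) (J K : R * R) :
  continuity h -> fst K <= snd K -> covers h J K ->
  fst (sub h J K) <= snd (sub h J K) /\ (forall x, inI (sub h J K) x -> inI J x) /\
  (forall x, inI (sub h J K) x -> inI K (h x)) /\ covers h (sub h J K) K.
Proof. intros H1 H2 H3. unfold sub. apply epsilon_spec, subinterval; assumption. Qed.

(* Every digit of [al] and of the index [i] is repeated infinitely often, so that
   distinct codes differ at infinitely many places. *)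
Definition code (i : nat) (al : nat -> bool) (j : nat) : bool :=
  let k := fst (of_nat j) in
  if Nat.even k then al (Nat.div2 k) else Nat.leb (Nat.div2 k) i.

Definition often (P : nat -> Prop) : Prop := forall N, exists j, (N <= j)%nat /\ P j.

(** The pairing puts [k] in the first component of [to_nat (k, N)] for every [N]. *)
Lemma often_digit (P : nat -> Prop) (k : nat) :
  (forall j, fst (of_nat j) = k -> P j) -> often P.
Proof.
  intros H N. exists (to_nat (k, N)). split.
  - pose proof (to_nat_non_decreasing k N). lia.
  - apply H. rewrite cancel_of_to. reflexivity.
Qed.

(** The first component 1 carries the test [0 <= i], which always succeeds. *)
Lemma code_often_true (i : nat) (al : nat -> bool) : often (fun j => code i al j = true).
Proof. apply (often_digit _ 1). intros j Hj. unfold code. rewrite Hj. reflexivity. Qed.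

(** For [i <> i'] the test [max i i' <= _] succeeds for exactly one of the two; otherwise the even
    component [2 * k] shows the digit [k] itself. *)
Lemma code_often_neq (i i' : nat) (al al' : nat -> bool) (k : nat) :
  i <> i' \/ al k <> al' k -> often (fun j => code i al j <> code i' al' j).
Proof.
  intros [H|H].
  - apply (often_digit _ (S (2 * max i i'))). intros j Hj. unfold code. rewrite Hj.
    rewrite Nat.even_succ, Nat.odd_mul, Nat.div2_succ_double. simpl.
    destruct (Nat.leb_spec (max i i') i), (Nat.leb_spec (max i i') i'); [lia| | |lia]; discriminate.
  - apply (often_digit _ (2 * k)). intros j Hj. unfold code. rewrite Hj.
    rewrite Nat.even_mul, Nat.div2_double. exact H.
Qed.

(** The pairing dominates its components, so digit [j] of the code reads a digit of [al] of index at
    most [j]. Thus coding is continuous. *)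
Lemma code_agree (i M : nat) (al be : nat -> bool) :
  agree M al be -> agree M (code i al) (code i be).
Proof.
  intros H j Hj. unfold code. rewrite H; [reflexivity|].
  assert (Hk : (fst (of_nat j) <= j)%nat).
  { pose proof (cancel_to_of j) as E. destruct (of_nat j) as [k r].
    pose proof (to_nat_non_decreasing k r). simpl. lia. }
  pose proof (Nat.div2_decr (fst (of_nat j)) j). lia.
Qed.

(** * A countable grid of intervals in the unit interval *)

(** The remainder turns every pair [(k, q)] into a cell of mesh [1 / S q] inside the unit interval,
    so each index is legal. *)
Definition grid (i : nat) : R * R :=
  let (k, q) := of_nat i in
  (INR (k mod S q) / INR (S q), (INR (k mod S q) + 1) / INR (S q)).

Lemma grid_in (i : nat) :
  fst (grid i) < snd (grid i) /\ forall x, inI (grid i) x -> I01 x.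
Proof.
  unfold grid. destruct (of_nat i) as [k q]. unfold inI, fst, snd.
  pose proof (Nat.mod_upper_bound k (S q) ltac:(lia)) as Hlt.
  set (j := (k mod S q)%nat) in *.
  assert (Hq : 0 < INR (S q)) by (apply lt_0_INR; lia).
  apply le_INR in Hlt. rewrite S_INR in Hlt. pose proof (pos_INR j) as Hj.
  split.
  - apply Rmult_lt_compat_r; [apply Rinv_0_lt_compat, Hq|lra].
  - intros x [H1 H2]. split.
    + apply Rle_trans with (2 := H1). apply Rmult_le_pos; [exact Hj|].
      apply Rlt_le, Rinv_0_lt_compat, Hq.
    + apply (Rle_trans _ _ _ H2). apply (Rmult_le_reg_r (INR (S q))); [exact Hq|].
      unfold Rdiv. rewrite Rmult_assoc, Rinv_l by lra. lra.
Qed.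

(** Induction on an integer bound for [x * INR (S q)], rather than an integer part, puts [x = 1]
    into the last closed cell. *)
Lemma grid_cell (x : R) (q : nat) : I01 x ->
  exists k, (k < S q)%nat /\ INR k <= x * INR (S q) <= INR k + 1.
Proof.
  intros [Hx0 Hx1].
  assert (H : forall n, x * INR (S q) <= INR (S n) ->
    exists k, (k < S n)%nat /\ INR k <= x * INR (S q) <= INR k + 1).
  { induction n as [|n IH]; intros H.
    - exists 0%nat. rewrite INR_1 in H. rewrite INR_0. split; [lia|].
      split; [|lra]. apply Rmult_le_pos; [exact Hx0|]. apply pos_INR.
    - destruct (Rle_lt_dec (x * INR (S q)) (INR (S n))) as [H1|H1].
      + destruct (IH H1) as [k [Hk1 Hk2]]. exists k. split; [lia|exact Hk2].
      + exists (S n). split; [lia|]. rewrite <- S_INR. lra. }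
  apply H. pose proof (pos_INR (S q)). nra.
Qed.

Lemma grid_dense (x r : R) : I01 x -> 0 < r ->
  exists i, forall y, inI (grid i) y -> Rabs (y - x) < r.
Proof.
  intros Hx Hr. destruct (archimed_cor1 r Hr) as [q [Hq1 Hq2]].
  destruct q as [|q]; [lia|].
  destruct (grid_cell x q Hx) as [k [Hk1 Hk2]].
  exists (to_nat (k, q)). unfold grid. rewrite cancel_of_to, Nat.mod_small by exact Hk1.
  assert (Hq : 0 < INR (S q)) by (apply lt_0_INR; lia).
  intros y [Hy1 Hy2]; unfold fst in Hy1; unfold snd in Hy2.
  assert (Hi : 0 < / INR (S q)) by (apply Rinv_0_lt_compat, Hq).
  assert (H1 : INR k / INR (S q) <= x).
  { apply (Rmult_le_reg_r (INR (S q))); [exact Hq|].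
    unfold Rdiv. rewrite Rmult_assoc, Rinv_l by lra. lra. }
  assert (H2 : x <= (INR k + 1) / INR (S q)).
  { apply (Rmult_le_reg_r (INR (S q))); [exact Hq|].
    unfold Rdiv. rewrite Rmult_assoc, Rinv_l by lra. lra. }
  unfold Rdiv in *. rewrite Rmult_plus_distr_r in *. apply Rabs_def1; lra.
Qed.

(** * The horseshoe: nested levels and itineraries *)

Section Horseshoe.

Context (g : R -> R) (a b c d : R).
Context (g_cont : continuity g) (g_I01 : maps_I01 g).
Context (a_ge0 : 0 <= a) (ab : a <= b) (bc : b < c) (cd : c <= d) (d_le1 : d <= 1).
Context (cov_ab : covers g (a, b) (a, d)) (cov_cd : covers g (c, d) (a, d)).
(** The form in which mixing enters here: no nondegenerate interval has all its late images inside
    [(a, d)]. *)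
Context (escape : forall u v, I01 u -> I01 v -> u < v -> forall m0,
  exists m z, (m0 <= m)%nat /\ u <= z <= v /\ ~ inI (a, d) (iter m g z)).

Fixpoint level (l : nat) : R * R :=
  match l with O => (a, b) | S k => sub g (level k) (level k) end.

(** Level [S l] maps onto level [l], which contains level [S l]; so it covers itself and the
    recursion continues. *)
Lemma level_covers (l : nat) :
  fst (level l) <= snd (level l) /\ covers g (level l) (level l).
Proof.
  induction l as [|l [IH1 IH2]].
  - split; [exact ab|]. apply (covers_sub _ _ (a, d)); [|exact cov_ab].
    unfold inI; simpl; intros; lra.
  - destruct (sub_spec g _ _ g_cont IH1 IH2) as [H1 [H2 [_ H4]]].
    split; [exact H1|]. apply (covers_sub _ _ (level l)); assumption.
Qed.

Lemma level_succ (l : nat) :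
  (forall x, inI (level (S l)) x -> inI (level l) x) /\
  (forall x, inI (level (S l)) x -> inI (level l) (g x)) /\
  covers g (level (S l)) (level l).
Proof.
  destruct (level_covers l) as [H1 H2].
  destruct (sub_spec g _ _ g_cont H1 H2) as [_ H]. exact H.
Qed.

Lemma level_mono (k l : nat) (x : R) : (k <= l)%nat -> inI (level l) x -> inI (level k) x.
Proof.
  intros H. induction H as [|l H IH]; [auto|]. intros Hx. apply IH, level_succ, Hx.
Qed.

Lemma level_iter (l : nat) : forall x, inI (level l) x -> inI (a, b) (iter l g x).
Proof.
  induction l as [|l IH]; intros x Hx; [exact Hx|].
  replace (S l) with (l + 1)%nat by lia. rewrite iter_add. apply IH, level_succ, Hx.
Qed.

(** By convexity everything between two common points is common too, and this whole interval would
    be trapped, against [escape]. *)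
Lemma trapped_unique (J : nat -> R * R) (n0 : nat) :
  (forall x, (forall m, inI (J m) x) -> I01 x) ->
  (forall m x, (n0 <= m)%nat -> (forall k, inI (J k) x) -> inI (a, d) (iter m g x)) ->
  forall x y, (forall m, inI (J m) x) -> (forall m, inI (J m) y) -> x = y.
Proof.
  intros H1 H3.
  assert (Hlt : forall x y, (forall m, inI (J m) x) -> (forall m, inI (J m) y) -> ~ x < y).
  { intros x y Hx Hy Hxy.
    destruct (escape x y (H1 x Hx) (H1 y Hy) Hxy n0) as [m [z [Hm [Hz Hout]]]].
    apply Hout, H3; [exact Hm|]. intros k. specialize (Hx k). specialize (Hy k).
    unfold inI in *. lra. }
  intros x y Hx Hy. destruct (Rtotal_order x y) as [H|[H|H]]; [|exact H|];
    exfalso; eapply Hlt; [| | exact H| | |exact H]; assumption.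
Qed.

(** A point of all levels has its whole orbit in [(a, b)], so there is only one. *)
Lemma levels_shrink : exists p, forall r, 0 < r ->
  exists L, forall l x, (L <= l)%nat -> inI (level l) x -> Rabs (x - p) < r.
Proof.
  destruct (nested_intervals level) as [p [_ Hp]].
  - intros m. apply level_covers.
  - intros m x. apply level_succ.
  - apply (trapped_unique level 0).
    + intros x Hx. specialize (Hx 0%nat). unfold inI in Hx; simpl in Hx. unfold I01; lra.
    + intros m x _ Hx. specialize (Hx m). apply level_iter in Hx.
      unfold inI in *; simpl in *; lra.
  - exists p. intros r Hr. destruct (Hp r Hr) as [L HL]. exists L.
    intros l x Hl Hx. apply HL, (level_mono L l); assumption.
Qed.

(* Only the times [2 ^ j] carry a digit; just after each of them the orbit dives
   so deep into the nested intervals that it reaches [(a, b)] just before [2 ^ (S j)]. *)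
Definition target (ga : nat -> bool) (m : nat) : R * R :=
  let j := Nat.log2 m in
  if Nat.eqb m (2 ^ j) then (if ga j then (c, d) else (a, b))
  else level (2 ^ S j - m - 1).

Lemma target_pow2 (ga : nat -> bool) (j : nat) :
  target ga (2 ^ j) = if ga j then (c, d) else (a, b).
Proof.
  unfold target. rewrite Nat.log2_pow2 by lia. rewrite Nat.eqb_refl. reflexivity.
Qed.

Lemma target_between (ga : nat -> bool) (j m : nat) :
  (2 ^ j < m < 2 ^ S j)%nat -> target ga m = level (2 ^ S j - m - 1).
Proof.
  intros H. unfold target. rewrite (Nat.log2_unique m j) by lia.
  destruct (Nat.eqb_spec m (2 ^ j)); [lia|reflexivity].
Qed.

Lemma pow2_position (m : nat) : (1 <= m)%nat ->
  exists j, m = (2 ^ j)%nat \/ (2 ^ j < m < 2 ^ S j)%nat.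
Proof.
  intros H. exists (Nat.log2 m). pose proof (Nat.log2_spec m H). lia.
Qed.

Lemma target_in (ga : nat -> bool) (m : nat) : (1 <= m)%nat ->
  fst (target ga m) <= snd (target ga m) /\ forall x, inI (target ga m) x -> inI (a, d) x.
Proof.
  intros Hm. destruct (pow2_position m Hm) as [j [->|Hj]].
  - rewrite target_pow2. destruct (ga j); unfold inI; simpl; split; intros; lra.
  - rewrite (target_between ga j m Hj). split; [apply level_covers|].
    intros x Hx. apply (level_mono 0) in Hx; [|lia]. unfold inI in *; simpl in *; lra.
Qed.

(** At a power of 2 both choices cover [(a, d)], hence any next target; in between, each level
    covers the one before it. *)
Lemma target_covers (ga : nat -> bool) (m : nat) : (1 <= m)%nat ->
  covers g (target ga m) (target ga (S m)).
Proof.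
  intros Hm. destruct (pow2_position m Hm) as [j [->|Hj]].
  - apply (covers_sub _ _ (a, d)); [apply target_in; lia|].
    rewrite target_pow2. destruct (ga j); assumption.
  - rewrite (target_between ga j m Hj).
    (* Just before the next power the depth is 0, and [(a, b)] covers either choice. *)
    destruct (Nat.eq_dec (S m) (2 ^ S j)) as [E|E].
    + replace (2 ^ S j - m - 1)%nat with 0%nat by lia.
      apply (covers_sub _ _ (a, d)); [apply target_in; lia|exact cov_ab].
    + rewrite (target_between ga j (S m)) by lia.
      replace (2 ^ S j - m - 1)%nat with (S (2 ^ S j - S m - 1)) by lia.
      apply level_succ.
Qed.

Lemma target_ext (ga ga' : nat -> bool) (m : nat) : (1 <= m)%nat ->
  agree m ga ga' -> target ga m = target ga' m.
Proof.
  intros Hm H. unfold target. rewrite (H (Nat.log2 m)); [reflexivity|].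
  apply Nat.log2_lt_lin; lia.
Qed.

Definition follows (ga : nat -> bool) (n0 : nat) (x : R) : Prop :=
  forall m, (n0 <= m)%nat -> inI (target ga m) (iter m g x).

(** Trimming for the whole iterate keeps the intervals nested in [J0]. Points of stage [m] meet the
    targets at the times from [n0] to [n0 + m - 1]. *)
Fixpoint track (J0 : R * R) (n0 : nat) (ga : nat -> bool) (m : nat) : R * R :=
  match m with
  | O => J0
  | S k => sub (iter (n0 + k) g) (track J0 n0 ga k) (target ga (n0 + k))
  end.

(** Stage [m] consults only digits below [n0 + m], and [sub] is a fixed choice. The continuity of
    coded points in the code rests on this. *)
Lemma track_ext (J0 : R * R) (n0 : nat) (ga ga' : nat -> bool) (m : nat) : (1 <= n0)%nat ->
  agree (n0 + m) ga ga' -> track J0 n0 ga m = track J0 n0 ga' m.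
Proof.
  intros Hn. induction m as [|m IH]; intros H; [reflexivity|].
  simpl. rewrite IH, (target_ext ga ga'); [reflexivity|lia| |]; intros k Hk; apply H; lia.
Qed.

Section Entry.

Context (J0 : R * R) (n0 : nat) (n0_pos : (1 <= n0)%nat).
Context (J0_ne : fst J0 <= snd J0) (J0_I01 : forall x, inI J0 x -> I01 x).
Context (J0_covers : covers (iter n0 g) J0 (a, d)).

Lemma track_covers (ga : nat -> bool) (m : nat) :
  fst (track J0 n0 ga m) <= snd (track J0 n0 ga m) /\
  covers (iter (n0 + m) g) (track J0 n0 ga m) (target ga (n0 + m)).
Proof.
  induction m as [|m [IH1 IH2]].
  - split; [exact J0_ne|]. rewrite Nat.add_0_r.
    apply (covers_sub _ _ (a, d)); [apply target_in; lia|exact J0_covers].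
  - destruct (sub_spec (iter (n0 + m) g) (track J0 n0 ga m) (target ga (n0 + m)))
      as [H1 [_ [_ H4]]]; [apply continuity_iter, g_cont|apply target_in; lia|exact IH2|].
    split; [exact H1|]. rewrite Nat.add_succ_r.
    apply (covers_comp (iter (n0 + m) g) g _ (target ga (n0 + m))); [exact H4|].
    apply target_covers; lia.
Qed.

Lemma track_succ (ga : nat -> bool) (m : nat) (x : R) :
  inI (track J0 n0 ga (S m)) x ->
  inI (track J0 n0 ga m) x /\ inI (target ga (n0 + m)) (iter (n0 + m) g x).
Proof.
  intros Hx. destruct (track_covers ga m) as [_ H].
  destruct (sub_spec (iter (n0 + m) g) (track J0 n0 ga m) (target ga (n0 + m)))
      as [_ [H2 [H3 _]]]; [apply continuity_iter, g_cont|apply target_in; lia|exact H|].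
  split; [apply H2, Hx|apply H3, Hx].
Qed.

Lemma track_follows (ga : nat -> bool) (x : R) :
  (forall m, inI (track J0 n0 ga m) x) -> follows ga n0 x.
Proof.
  intros Hx m Hm. replace m with (n0 + (m - n0))%nat by lia.
  apply track_succ, Hx.
Qed.

(** All targets lie in [(a, d)], so points of every stage are trapped from time [n0] on and must
    coincide. *)
Lemma track_point (ga : nat -> bool) :
  exists x, (forall m, inI (track J0 n0 ga m) x) /\
    forall r, 0 < r -> exists M, forall y, inI (track J0 n0 ga M) y -> Rabs (y - x) < r.
Proof.
  apply nested_intervals.
  - intros m. apply track_covers.
  - intros m x Hx. apply track_succ, Hx.
  - apply (trapped_unique _ n0).
    + intros x Hx. apply J0_I01, (Hx 0%nat).
    + intros m x Hm Hx. apply (target_in ga m); [lia|]. apply (track_follows ga x Hx m Hm).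
Qed.

Lemma coded_points : exists pt : (nat -> bool) -> R,
  cantor_continuous pt /\ forall ga, inI J0 (pt ga) /\ follows ga n0 (pt ga).
Proof.
  destruct (choice _ track_point) as [pt Hpt]. exists pt. split.
  - intros ga r Hr. destruct (Hpt ga) as [_ H]. destruct (H r Hr) as [M HM].
    exists (n0 + M)%nat. intros be Hbe. apply HM.
    rewrite (track_ext J0 n0 ga be M n0_pos Hbe). apply Hpt.
  - intros ga. destruct (Hpt ga) as [H _]. split; [apply (H 0%nat)|apply track_follows, H].
Qed.

End Entry.

(** * Separation and proximality of coded orbits *)

(** At time [2 ^ j] with differing digits, one orbit is in [(a, b)] and the other in [(c, d)],
    across the gap from [b] to [c]. *)
Lemma separated_digit (ga de : nat -> bool) (n0 n1 : nat) (x y : R) :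
  follows ga n0 x -> follows de n1 y -> often (fun j => ga j <> de j) ->
  often (fun m => c - b <= Rabs (iter m g x - iter m g y)).
Proof.
  intros Hx Hy Hdiff N. destruct (Hdiff (N + n0 + n1)%nat) as [j [Hj Hne]].
  pose proof (Nat.pow_gt_lin_r 2 j ltac:(lia)) as Hlin.
  exists (2 ^ j)%nat. split; [lia|].
  specialize (Hx (2 ^ j)%nat ltac:(lia)). specialize (Hy (2 ^ j)%nat ltac:(lia)).
  rewrite target_pow2 in Hx, Hy. unfold inI in *.
  destruct (ga j), (de j); try congruence; simpl in *.
  - rewrite Rabs_right; lra.
  - rewrite Rabs_left; lra.
Qed.

(** When the first orbit is at a late power of 2 with digit [true], hence in [(c, d)], the other is
    off by [t - s], so strictly between powers and in [(a, b)]. *)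
Lemma separated_shift (ga de : nat -> bool) (n0 n1 s t : nat) (x y : R) :
  follows ga n0 x -> follows de n1 y -> often (fun j => ga j = true) -> s <> t ->
  often (fun m => c - b <= Rabs (iter (m + s) g x - iter (m + t) g y)).
Proof.
  intros Hx Hy Hga Hst N. destruct (Hga (N + n0 + n1 + s + t + 1)%nat) as [j [Hj Htrue]].
  (* A successor exponent provides the preceding block, which is where the second orbit is when
     [t < s]. *)
  destruct j as [|j]; [lia|].
  pose proof (Nat.pow_gt_lin_r 2 j ltac:(lia)) as Hlin.
  assert (Hp : (2 ^ S j = 2 * 2 ^ j)%nat) by reflexivity.
  assert (Hp' : (2 ^ S (S j) = 2 * 2 ^ S j)%nat) by reflexivity.
  exists (2 ^ S j - s)%nat. split; [lia|].
  specialize (Hx (2 ^ S j - s + s)%nat ltac:(lia)).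
  specialize (Hy (2 ^ S j - s + t)%nat ltac:(lia)).
  replace (target ga (2 ^ S j - s + s)) with (c, d) in Hx.
  2:{ replace (2 ^ S j - s + s)%nat with (2 ^ S j)%nat by lia.
      rewrite target_pow2, Htrue. reflexivity. }
  assert (Hy' : inI (a, b) (iter (2 ^ S j - s + t) g y)).
  { destruct (Nat.lt_ge_cases s t) as [H|H].
    - rewrite (target_between de (S j)) in Hy by lia.
      apply (level_mono 0) in Hy; [exact Hy|lia].
    - rewrite (target_between de j) in Hy by lia.
      apply (level_mono 0) in Hy; [exact Hy|lia]. }
  unfold inI in *; simpl in *. rewrite Rabs_right; lra.
Qed.

(** Both orbits are near [p] whenever both shifted times lie in one dyadic block, more than [L]
    steps before its end. Such times recur with bounded gaps. *)
Lemma proximal (ga de : nat -> bool) (n0 n1 s t : nat) (x y : R) (eta : R) :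
  follows ga n0 x -> follows de n1 y -> 0 < eta ->
  exists C, forall k, (C <= k)%nat -> exists i, (i <= C)%nat /\
    Rabs (iter (k + i + s) g x - iter (k + i + t) g y) < eta.
Proof.
  intros Hx Hy Heta. destruct levels_shrink as [p Hp].
  destruct (Hp (eta / 2) ltac:(lra)) as [L HL].
  assert (Hnear : forall ga n0 x m j, follows ga n0 x -> (n0 <= m)%nat ->
    (2 ^ j < m)%nat -> (m + L + 1 <= 2 ^ S j)%nat -> Rabs (iter m g x - p) < eta / 2).
  { intros ga' n0' x' m j Hf H1 H2 H3. specialize (Hf m H1).
    rewrite (target_between ga' j m) in Hf by lia. apply HL in Hf; [exact Hf|lia]. }
  (* The distance to the end of the block that suffices for either shift and for depth [L]. *)
  set (D := (s + t + L + 1)%nat).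
  (* Beyond [n0 + n1] both orbits follow their codes; the rest makes [k] exceed [D + 1], so the
     block has room. *)
  exists (n0 + n1 + 2 * (D + 2))%nat. intros k Hk.
  enough (exists i j, (i <= D + 1)%nat /\ (2 ^ j < k + i)%nat /\ (k + i + D <= 2 ^ S j)%nat)
    as [i [j [H1 [H2 H3]]]].
  { exists i. split; [lia|].
    pose proof (Hnear ga n0 x (k + i + s)%nat j Hx ltac:(lia) ltac:(lia) ltac:(lia)) as Ha.
    pose proof (Hnear de n1 y (k + i + t)%nat j Hy ltac:(lia) ltac:(lia) ltac:(lia)) as Hb.
    apply Rabs_def2 in Ha. apply Rabs_def2 in Hb. apply Rabs_def1; lra. }
  destruct (Nat.log2_spec k ltac:(lia)) as [Hlo Hhi]. set (j := Nat.log2 k) in *.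
  assert (Hp1 : (2 ^ S j = 2 * 2 ^ j)%nat) by reflexivity.
  assert (Hp2 : (2 ^ S (S j) = 2 * 2 ^ S j)%nat) by reflexivity.
  (* On a power of 2, step past it; with [D] steps left in the block, stay; otherwise move just
     beyond the next power. *)
  destruct (Nat.eq_dec k (2 ^ j)) as [E|E].
  - exists 1%nat, j. lia.
  - destruct (Nat.le_gt_cases (k + D) (2 ^ S j)) as [H|H].
    + exists 0%nat, j. lia.
    + exists (2 ^ S j + 1 - k)%nat, (S j). lia.
Qed.

(** * The invariant scrambled set of the horseshoe *)

Context (entry : forall u v, I01 u -> I01 v -> u < v ->
  exists n0, (1 <= n0)%nat /\ covers (iter n0 g) (u, v) (a, d)).

(** Points carry labels: grid cell [i], code [al], shift [s]. Different labels give separation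
    infinitely often; this is the scrambling estimate and also the injectivity that makes each piece
    a Cantor set. *)
Lemma horseshoe_scrambled : exists T : R -> Prop,
  mycielski T /\ dense_in_I01 T /\ (forall t, T t -> T (g t)) /\
  (exists x y, T x /\ T y /\ x <> y) /\
  forall x y, T x -> T y -> x <> y ->
    (forall eta, 0 < eta -> exists C, forall k, (C <= k)%nat -> exists i, (i <= C)%nat /\
       Rabs (iter (k + i) g x - iter (k + i) g y) < eta) /\
    often (fun m => c - b <= Rabs (iter m g x - iter m g y)).
Proof.
  assert (Hpts : forall i, exists np : nat * ((nat -> bool) -> R),
    cantor_continuous (snd np) /\
    forall ga, inI (grid i) (snd np ga) /\ follows ga (fst np) (snd np ga)).
  { intros i. destruct (grid_in i) as [Hlt HI].
    destruct (entry (fst (grid i)) (snd (grid i))) as [n0 [Hn0 Hcov]];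
      [apply HI; unfold inI; lra|apply HI; unfold inI; lra|exact Hlt|].
    destruct (coded_points (grid i) n0 Hn0) as [pt Hpt];
      [lra|exact HI|rewrite (surjective_pairing (grid i)); exact Hcov|].
    exists (n0, pt). exact Hpt. }
  destruct (choice _ Hpts) as [np Hnp]. clear Hpts.
  pose (x := fun i al => snd (np i) (code i al)).
  assert (Hfol : forall i al, follows (code i al) (fst (np i)) (x i al)).
  { intros i al. apply Hnp. }
  assert (HxI : forall i al, I01 (x i al)).
  { intros i al. apply (grid_in i), Hnp. }
  assert (Hsep : forall i al s i' al' s' k, s <> s' \/ i <> i' \/ al k <> al' k ->
    often (fun m => c - b <= Rabs (iter m g (iter s g (x i al)) - iter m g (iter s' g (x i' al'))))).
  { intros i al s i' al' s' k H N.
    destruct (Nat.eq_dec s s') as [<-|Hs].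
    - destruct H as [H|H]; [congruence|].
      destruct (separated_digit _ _ _ _ _ _ (Hfol i al) (Hfol i' al')
        (code_often_neq i i' al al' k H) (N + s)%nat) as [m [Hm1 Hm2]].
      exists (m - s)%nat. split; [lia|]. rewrite <- !iter_add.
      replace (m - s + s)%nat with m by lia. exact Hm2.
    - destruct (separated_shift _ _ _ _ s s' _ _ (Hfol i al) (Hfol i' al')
        (code_often_true i al) Hs N) as [m [Hm1 Hm2]].
      exists m. split; [exact Hm1|]. rewrite <- !iter_add. exact Hm2. }
  assert (Hinj : forall i al s i' al' s' k, s <> s' \/ i <> i' \/ al k <> al' k ->
    iter s g (x i al) <> iter s' g (x i' al')).
  { intros i al s i' al' s' k H E. destruct (Hsep i al s i' al' s' k H 0%nat) as [m [_ Hm]].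
    rewrite E, Rminus_diag, Rabs_R0 in Hm. lra. }
  exists (fun z => exists i s al, z = iter s g (x i al)).
  split; [|split; [|split; [|split]]].
  - exists (fun j z => exists al, z = iter (snd (of_nat j)) g (x (fst (of_nat j)) al)).
    split.
    + intros j. destruct (of_nat j) as [i s]. simpl.
      apply (cantor_set_image (fun al => iter s g (x i al))).
      * intros al r Hr.
        destruct (proj1 (continuity_eps _) (continuity_iter g s g_cont) (x i al) r Hr)
          as [dl [Hd1 Hd2]].
        destruct (proj1 (Hnp i) (code i al) dl Hd1) as [M HM].
        exists M. intros be Hbe. apply Hd2, HM, code_agree, Hbe.
      * intros al be k E. apply NNPP; intros Hne.
        apply (Hinj i al s i be s k); [auto|exact E].
      * intros al. apply iter_I01; [exact g_I01|apply HxI].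
    + intros z. split.
      * intros [i [s [al ->]]]. exists (to_nat (i, s)), al. rewrite cancel_of_to. reflexivity.
      * intros [j [al ->]]. eexists _, _, _; reflexivity.
  - split.
    + intros z [i [s [al ->]]]. apply iter_I01; [exact g_I01|apply HxI].
    + intros z Hz r Hr. destruct (grid_dense z r Hz Hr) as [i Hi].
      exists (x i (fun _ => true)). split; [exists i, 0%nat, (fun _ => true); reflexivity|].
      apply Hi, Hnp.
  - intros z [i [s [al ->]]]. exists i, (S s), al. reflexivity.
  (* A point and its image have different shifts, hence are distinct. *)
  - exists (iter 0 g (x 0%nat (fun _ => true))), (iter 1 g (x 0%nat (fun _ => true))).
    split; [eexists _, _, _; reflexivity|split; [eexists _, _, _; reflexivity|]].
    apply (Hinj _ _ _ _ _ _ 0%nat). left; discriminate.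
  - intros z w [i [s [al ->]]] [i' [s' [al' ->]]] Hne. split.
    + intros eta Heta.
      destruct (proximal _ _ _ _ s s' _ _ eta (Hfol i al) (Hfol i' al') Heta) as [C HC].
      exists C. intros k Hk. destruct (HC k Hk) as [l [Hl1 Hl2]]. exists l.
      split; [exact Hl1|]. rewrite <- !iter_add. exact Hl2.
    + destruct (classic (s <> s' \/ i <> i' \/ exists k, al k <> al' k)) as [H|H].
      * destruct (classic (exists k, al k <> al' k)) as [[k Hk]|Hk].
        -- apply (Hsep _ _ _ _ _ _ k). auto.
        -- apply (Hsep _ _ _ _ _ _ 0%nat). tauto.
      * exfalso. apply Hne.
        assert (s = s') as <- by lia. assert (i = i') as <- by lia.
        replace al' with al; [reflexivity|].
        apply functional_extensionality. intros k. apply NNPP; intros Hk. apply H. eauto.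
Qed.

End Horseshoe.

(** * Mixing interval maps *)

(** The retraction onto the unit interval. Composing [f] with it gives a map continuous on the whole
    line with the same orbits inside. *)
Definition clamp (x : R) : R := Rmax 0 (Rmin x 1).

Lemma clamp_in (x : R) : I01 (clamp x).
Proof. unfold clamp, I01, Rmax, Rmin. repeat destruct (Rle_dec _ _); lra. Qed.

Lemma clamp_id (x : R) : I01 x -> clamp x = x.
Proof. unfold clamp, I01, Rmax, Rmin. repeat destruct (Rle_dec _ _); lra. Qed.

Lemma clamp_contracts (x y : R) : Rabs (clamp y - clamp x) <= Rabs (y - x).
Proof.
  unfold clamp, Rmax, Rmin, Rabs.
  repeat destruct (Rle_dec _ _); repeat destruct (Rcase_abs _); lra.
Qed.

Lemma continuity_clamp (f : R -> R) :
  continuous_on_I01 f -> continuity (fun x => f (clamp x)).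
Proof.
  intros Hf. apply continuity_eps. intros x eps He.
  destruct (Hf (clamp x) (clamp_in x) eps He) as [dl [Hd1 Hd2]].
  exists dl. split; [exact Hd1|]. intros y Hy. apply Hd2; [apply clamp_in|].
  pose proof (clamp_contracts x y). lra.
Qed.

Lemma iter_clamp (f : R -> R) (m : nat) (x : R) :
  maps_I01 f -> I01 x -> iter m (fun x => f (clamp x)) x = iter m f x.
Proof.
  intros Hf Hx. induction m as [|m IH]; [reflexivity|].
  simpl. rewrite IH, clamp_id; [reflexivity|]. apply iter_I01; assumption.
Qed.

Lemma open_interval_I01 (u v : R) : open_in_I01 (fun x => I01 x /\ u < x < v).
Proof.
  split; [tauto|]. intros x [Hx1 Hx2]. exists (Rmin (x - u) (v - x)).
  pose proof (Rmin_l (x - u) (v - x)). pose proof (Rmin_r (x - u) (v - x)).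
  split; [apply Rmin_pos; lra|]. intros y Hy1 Hy2. apply Rabs_def2 in Hy2.
  split; [exact Hy1|lra].
Qed.

(** The window may stick out of the unit interval, so that [p = -1] or [q = 2] describes a
    neighbourhood of an end. *)
Lemma mixing_hits (f : R -> R) (u v p q : R) :
  maps_I01 f -> mixing_I01 f -> I01 u -> I01 v -> u < v -> p < q -> 0 < q -> p < 1 ->
  exists N, forall m, (N <= m)%nat -> exists x, u < x < v /\
    p < iter m (fun x => f (clamp x)) x < q.
Proof.
  intros Hf Hmix Hu Hv Huv Hpq Hq Hp. unfold I01 in *.
  destruct (Hmix _ _ (open_interval_I01 u v) (open_interval_I01 p q)) as [N HN].
  - exists ((u + v) / 2). unfold I01. lra.
  (* The midpoint of the part of the window inside the unit interval. *)
  - exists ((Rmax 0 p + Rmin 1 q) / 2). unfold I01, Rmax, Rmin.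
    repeat destruct (Rle_dec _ _); lra.
  - exists N. intros m Hm. destruct (HN m Hm) as [x [[Hx1 Hx2] [_ Hx3]]].
    exists x. split; [exact Hx2|]. rewrite iter_clamp; assumption.
Qed.

(** Late images of [(u, v)] reach below [a] and above [d]; intermediate values fill the rest. *)
Lemma mixing_covers (f : R -> R) (u v a d : R) :
  maps_I01 f -> continuous_on_I01 f -> mixing_I01 f -> I01 u -> I01 v -> u < v ->
  0 < a < 1 -> 0 < d < 1 ->
  exists N, forall m, (N <= m)%nat -> covers (iter m (fun x => f (clamp x))) (u, v) (a, d).
Proof.
  intros Hf Hc Hmix Hu Hv Huv Ha Hd.
  destruct (mixing_hits f u v (-1) a) as [N1 H1]; try assumption; try lra.
  destruct (mixing_hits f u v d 2) as [N2 H2]; try assumption; try lra.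
  exists (max N1 N2). intros m Hm y Hy.
  destruct (H1 m ltac:(lia)) as [x1 [Hx1 Hy1]], (H2 m ltac:(lia)) as [x2 [Hx2 Hy2]].
  pose proof (continuity_iter _ m (continuity_clamp f Hc)) as Hcm.
  unfold inI in *; simpl in *.
  destruct (Rle_lt_dec x1 x2) as [H|H].
  - destruct (ivt _ x1 x2 y Hcm) as [z [Hz1 Hz2]]; [lra|left; lra|].
    exists z. split; [lra|exact Hz2].
  - destruct (ivt _ x2 x1 y Hcm) as [z [Hz1 Hz2]]; [lra|right; lra|].
    exists z. split; [lra|exact Hz2].
Qed.

(** * Transfer from the horseshoe of an iterate to the mixing map *)

Lemma syndetic_multiples (S : nat -> Prop) (N C : nat) :
  (0 < N)%nat ->
  (forall k, (C <= k)%nat -> exists i, (i <= C)%nat /\ S ((k + i) * N)%nat) ->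
  syndetic S.
Proof.
  intros HN HS A HA. destruct (HA ((2 * C + 2) * N)%nat) as [k0 Hk0].
  pose proof (Nat.div_mod_eq k0 N) as Hdiv.
  pose proof (Nat.mod_upper_bound k0 N ltac:(lia)) as Hmod.
  (* The resulting multiple of [N] exceeds [k0] by at most [(2 * C + 1) * N], so it falls within the
     run starting at [k0]. *)
  destruct (HS (C + k0 / N + 1)%nat) as [i [Hi1 Hi2]]; [lia|].
  eexists; split; [exact Hi2|].
  replace ((C + k0 / N + 1 + i) * N)%nat
    with (k0 + ((C + k0 / N + 1 + i) * N - k0))%nat by nia.
  apply Hk0. nia.
Qed.

Theorem theorem7p1 (f : R -> R) :
  maps_I01 f -> continuous_on_I01 f -> mixing_I01 f ->
  exists (n : nat) (eps : R) (T : R -> Prop),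
    0 < eps /\ mycielski T /\ dense_in_I01 T /\
    (forall t, T t -> T (iter (2 ^ n) f t)) /\
    syndetically_scrambled f eps T.
Proof.
  intros Hf Hc Hmix.
  set (F := fun x => f (clamp x)).
  assert (HF : continuity F) by (apply continuity_clamp, Hc).
  assert (HFI : maps_I01 F) by (intros x _; apply Hf, clamp_in).
  assert (Hcov : forall u v, I01 u -> I01 v -> u < v -> exists N, forall m, (N <= m)%nat ->
    covers (iter m F) (u, v) (1/5, 4/5)).
  { intros u v Hu Hv Huv. apply mixing_covers; try assumption; lra. }
  destruct (Hcov (1/5) (2/5)) as [N1 HN1]; [unfold I01; lra|unfold I01; lra|lra|].
  destruct (Hcov (3/5) (4/5)) as [N2 HN2]; [unfold I01; lra|unfold I01; lra|lra|].
  (* Since [2 ^ n > n], the iterate is past both covering thresholds. *)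
  pose (n := max N1 N2).
  pose proof (Nat.pow_gt_lin_r 2 n ltac:(lia)) as Hn.
  destruct (horseshoe_scrambled (iter (2 ^ n) F) (1/5) (2/5) (3/5) (4/5))
    as [T [HM [HD [HT [Hxy Hpair]]]]]; try lra.
  - apply continuity_iter, HF.
  - intros x Hx. apply iter_I01; assumption.
  - apply HN1; lia.
  - apply HN2; lia.
  - intros u v Hu Hv Huv m0.
    (* Escape happens to the left: some late image falls below [1/5]. *)
    destruct (mixing_hits f u v (-1) (1/5)) as [N HN]; try assumption; try lra.
    exists (N + m0)%nat. destruct (HN ((N + m0) * 2 ^ n)%nat) as [z [Hz1 Hz2]]; [nia|].
    exists z. split; [lia|split; [lra|]]. rewrite <- iter_mul. unfold inI; simpl. fold F in Hz2. lra.
  - intros u v Hu Hv Huv. destruct (Hcov u v Hu Hv Huv) as [N HN].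
    exists (S N). split; [lia|]. intros y Hy.
    destruct (HN (S N * 2 ^ n)%nat ltac:(nia) y Hy) as [x [Hx1 Hx2]].
    exists x. split; [exact Hx1|]. rewrite <- iter_mul. exact Hx2.
  - assert (HTF : forall m t, T t -> iter m F t = iter m f t).
    { intros m t Ht. apply iter_clamp; [exact Hf|apply HD, Ht]. }
    (* The separation constant is the gap [3/5 - 2/5]. *)
    exists n, (1/5), T. split; [lra|split; [exact HM|split; [exact HD|split]]].
    { intros t Ht. rewrite <- HTF by exact Ht. apply HT, Ht. }
    split; [exact Hxy|]. intros x y Hx Hy Hne.
    destruct (Hpair x y Hx Hy Hne) as [Hprox Hoft].
    assert (Hoften : forall N, exists m, (N <= m)%nat /\
      1/5 <= Rabs (iter m f x - iter m f y)).
    { intros N. destruct (Hoft N) as [m [Hm1 Hm2]]. exists (m * 2 ^ n)%nat. split; [nia|].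
      rewrite <- !iter_mul, !HTF in Hm2 by assumption. lra. }
    split; [|split].
    + intros eta Heta. destruct (Hprox eta Heta) as [C HC].
      apply (syndetic_multiples _ (2 ^ n) C); [lia|].
      intros k Hk. destruct (HC k Hk) as [i [Hi1 Hi2]]. exists i. split; [exact Hi1|].
      rewrite <- !iter_mul, !HTF in Hi2 by assumption. exact Hi2.
    + intros Hcv. destruct (Hcv (1/5)) as [N HN]; [lra|].
      destruct (Hoften N) as [m [Hm1 Hm2]]. specialize (HN m Hm1).
      unfold Rdist in HN. rewrite Rminus_0_r, Rabs_Rabsolu in HN. lra.
    + intros e He N. destruct (Hoften N) as [m [Hm1 Hm2]]. exists m. split; [exact Hm1|lra].
Qed.
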